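(* Let $N = (C_3^2 \rtimes Q_8) \times C_2$, where the quaternion group $Q_8$ of order $8$ acts faithfully on $C_3^2$ (so $|N| = 144$; this is $\mathtt{SmallGroup}(144,187)$ in the GAP library). Then Gaschütz's theorem does not hold for $N$. That is, there exist finite groups $G$ and $H$ with $N \unlhd G$, $N \le H \le G$ and $\gcd(|N|, [G:H]) = 1$ such that $N$ has a complement in $H$ but $N$ has no complement in $G$.
   Context: All groups are finite. $C_n$ denotes the cyclic group of order $n$. A complement of a normal subgroup $N \unlhd G$ is a subgroup $C \le G$ with $G = NC$ and $N \cap C = 1$. ''Gaschütz's theorem holds for $N$'' means: for all finite groups $G$ and $H$ with $N \unlhd G$, $N \le H \le G$ and $\gcd(|N|, [G:H]) = 1$, if $N$ has a complement in $H$, then $N$ has a complement in $G$. As usual, $N \unlhd G$ is understood up to identifying $N$ with an isomorphic copy. *)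

(* Defs.v *)
From HB Require Import structures.
From mathcomp Require Import all_boot all_fingroup all_algebra all_solvable.

Set Implicit Arguments.
Unset Strict Implicit.
Unset Printing Implicit Defensive.

Local Open Scope group_scope.

(* The normal subgroup M of G is a copy of N, which is given up to isomorphism.
   [splits G, over M] says that M has a complement in G. *)
Definition gaschutz_holds (nT : finGroupType) (N : {group nT}) : Prop :=
  forall (gT : finGroupType) (G H M : {group gT}),
    M \isog N -> M <| G -> M \subset H -> H \subset G ->
    coprime #|M| #|G : H| ->
    [splits H, over M] -> [splits G, over M].

(* N is the internal product (K ><| Q) \x Z. The product type 'Z_3 * 'Z_3 and
   the type 'Z_2 carry their additive group structures, and 'J is the action
   of Q on K by conjugation. A faithful action of the quaternion group of order
   8 on C_3 x C_3 is unique up to isomorphism of the semidirect product, so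
   this predicate determines N up to isomorphism. *)
Definition is_C3C3_Q8_x_C2 (nT : finGroupType) (N : {group nT}) : Prop :=
  exists K Q L Z : {group nT},
    [/\ K \isog [set: 'Z_3 * 'Z_3], Q \isog 'Q_8 & Z \isog [set: 'Z_2]]
    /\ [/\ K ><| Q = L, [faithful Q, on K | 'J] & L \x Z = N].

(* Main.v *)
(** Write L for C_3^2 ><| Q_8 and Z for C_2. Let e : L -> C_2 be the map onto
    Q_8 / <x>, and let A = C_4 ><| L with L inverting C_4 = <z> through e, so
    that N = Z \x L has index 2 in A. Given a nontrivial group I of order prime
    to #|N|, take
      G = { (x, (u, s)) in A * (A wr I) | every u_i lies in N x },
      H = { s = 1 } and M = N * 1.
    Then #|G : H| divides #|I|, and { x = u_1 } is a complement of M in H.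

    A complement of M in G is the graph of a homomorphism c to A with
    c (u, s) in N u_i. As #|I| is prime to #|N|, c kills I, so that for b in N
    the image phi b of "b at place p, 1 elsewhere" does not depend on p. Since
    different places commute, phi has abelian image. Choose i and j in Q_8 with
    e i = 1 and i^2 = [i, j], so z^2 = [z, i]; then y = c (z, ..., z) satisfies
      y^2 = phi (z^2)^#|I| = phi (z^2) = [y, phi i]  (z^4 = 1 and #|I| is odd),
      (phi i)^2 = phi [i, j] = 1,
    and a computation in A shows that no y in N z has such a square. *)

Require Import Defs.
From HB Require Import structures.
From mathcomp Require Import all_boot all_fingroup all_algebra all_solvable.

Set Implicit Arguments.
Unset Strict Implicit.
Unset Printing Implicit Defensive.

Local Open Scope group_scope.

(** * The regular wreath product A wr I *)

Definition wreath (aT iT : finGroupType) : Type := ({ffun iT -> aT} * iT)%type.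

Section WreathGroup.

Variables aT iT : finGroupType.
Local Notation wT := (wreath aT iT).

HB.instance Definition _ := Finite.copy wT ({ffun iT -> aT} * iT)%type.

(** The top group permutes the places by right translation, hence transitively: a shift can carry
    any place to place 1. *)
Definition wreath_mul (v w : wT) : wT :=
  ([ffun i => v.1 i * w.1 (i * v.2)], v.2 * w.2).
Definition wreath_one : wT := ([ffun=> 1], 1).
Definition wreath_inv (w : wT) : wT :=
  ([ffun i => (w.1 (i * w.2^-1))^-1], w.2^-1).

Lemma wreath_mulA : associative wreath_mul.
Proof.
move=> u v w; congr (_, _); rewrite /= ?mulgA //.
by apply/ffunP=> i; rewrite !ffunE !mulgA.
Qed.

Lemma wreath_mul1 : left_id wreath_one wreath_mul.
Proof.
case=> u s; congr (_, _); rewrite /= ?mul1g //.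
by apply/ffunP=> i; rewrite !ffunE mul1g mulg1.
Qed.

Lemma wreath_mulV : left_inverse wreath_one wreath_inv wreath_mul.
Proof.
case=> u s; congr (_, _); rewrite /= ?mulVg //.
by apply/ffunP=> i; rewrite !ffunE mulVg.
Qed.

HB.instance Definition _ :=
  Finite_isGroup.Build wT wreath_mulA wreath_mul1 wreath_mulV.

Lemma wreath1 : (1 : wT) = ([ffun=> 1], 1).
Proof. by []. Qed.

End WreathGroup.

(** * The groups G, H and M, and the complements of M *)

Section WreathFibreProduct.

Variables (aT iT : finGroupType) (A N : {group aT}).
Hypothesis nsNA : N <| A.
Local Notation wT := (wreath aT iT).
Local Notation gT := (aT * wT)%type.

Let sNA : N \subset A. Proof. exact: normal_sub. Qed.
Let nNA : A \subset 'N(N). Proof. exact: normal_norm. Qed.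

Definition fibre_set : {set gT} :=
  [set g : gT | (g.1 \in A) && [forall i, g.2.1 i \in N :* g.1]].

Lemma fibreP x (u : {ffun iT -> aT}) s :
  reflect (x \in A /\ forall i, u i \in N :* x) ((x, (u, s)) \in fibre_set).
Proof.
rewrite inE; apply: (iffP andP) => /= -[Ax]; first by move/forallP.
by move=> Hu; split=> //; apply/forallP.
Qed.

Lemma group_set_fibre : group_set fibre_set.
Proof.
apply/group_setP; split.
  by apply/fibreP; split=> // i; rewrite ffunE rcoset_refl.
case=> x [u s] [y [v t]] /fibreP[Ax Hu] /fibreP[Ay Hv].
apply/fibreP; split=> /= [|i]; first exact: groupM.
have NAx := subsetP nNA x Ax.
by rewrite ffunE -rcoset_mul // mem_mulg.
Qed.
Canonical fibre_group := Group group_set_fibre.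

Definition top_of (g : gT) : iT := g.2.2.
Lemma top_ofM : {in setT &, {morph top_of : g h / g * h}}.
Proof. by []. Qed.
Canonical top_of_morphism := Morphism top_ofM.

(** This is H. As the kernel of a homomorphism from G to I, it has index dividing [#|iT|]. *)
Definition fibre_base : {group gT} := 'ker_fibre_group top_of.

Lemma fibre_baseP x (u : {ffun iT -> aT}) s :
  reflect ((x, (u, s)) \in fibre_set /\ s = 1)
          ((x, (u, s)) \in fibre_base).
Proof.
apply: (iffP setIP) => -[->].
  by move=> Kg; split=> //; exact: (@mker _ _ _ top_of_morphism _ Kg).
by move=> s1; split=> //; apply/(@kerP _ _ _ top_of_morphism); rewrite ?inE.
Qed.

Definition fibre_fst : {group gT} := (setX N 1)%G.

Lemma fibre_fstP x w : reflect (x \in N /\ w = 1) ((x, w) \in fibre_fst).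
Proof. by rewrite in_setX; apply: (iffP andP) => -[-> /set1P]. Qed.

Lemma fibre_fst_normal : fibre_fst <| fibre_group.
Proof.
apply/andP; split; apply/subsetP=> -[x [u s]].
  case/fibre_fstP=> Nx [-> _]; apply/fibreP; split=> [|i].
    exact: (subsetP sNA).
  by rewrite ffunE mem_rcoset mul1g groupV.
case/fibreP=> Ax _; rewrite inE; apply/subsetP=> g.
case/imsetP=> -[y w] /fibre_fstP[Ny ->] ->; apply/fibre_fstP; split.
  by rewrite /= memJ_norm // (subsetP nNA).
exact: (conj1g ((u, s) : wT)).
Qed.

Lemma fibre_fst_sub_base : fibre_fst \subset fibre_base.
Proof.
apply/subsetP=> -[x [u s]] xM; apply/fibre_baseP; split.
  exact: (subsetP (normal_sub fibre_fst_normal)).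
by case/fibre_fstP: xM => _ [].
Qed.

Lemma fibre_base_index : #|fibre_group : fibre_base| %| #|iT|.
Proof.
rewrite indexgI.
have:= card_morphim top_of_morphism fibre_group; rewrite setTI => <-.
by rewrite -cardsT cardSg ?subsetT.
Qed.

(** Where s = 1 the product is taken place by place, so evaluation at place 1 is a homomorphism; its
    graph is the complement. *)
Lemma fibre_base_splits : [splits fibre_base, over fibre_fst].
Proof.
pose diag (g : gT) := g.2.1 1 == g.1.
have gT0 : group_set [set g in fibre_base | diag g].
  apply/group_setP; split.
    by rewrite inE group1 /diag /= ffunE eqxx.
  case=> x [u s] [y [v t]] /setIdP[Hg /eqP/= ug] /setIdP[Hh /eqP/= vh].
  have [_ s1] := fibre_baseP _ _ _ Hg.
  by rewrite in_set groupM // /diag /= ffunE s1 mulg1 ug vh eqxx.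
apply/splitsP; exists (Group gT0); apply/complP; split.
  apply/trivgP/subsetP=> -[x [u s]] /setIP[/fibre_fstP[Nx [-> ->]]].
  by case/setIdP=> _ /eqP/=; rewrite ffunE => <-; rewrite inE.
apply/eqP; rewrite eqEsubset mul_subG ?fibre_fst_sub_base //=.
  apply/subsetP=> -[x [u s]] /fibre_baseP[/fibreP[Ax Hu] s1].
  apply/mulsgP; exists (x * (u 1)^-1, 1) (u 1, (u, s)).
  - apply/fibre_fstP; split=> //; have := Hu 1.
    by rewrite mem_rcoset -groupV invMg invgK.
  - have Au : u 1 \in A.
      have /rcosetP[n Nn ->] := Hu 1.
      by rewrite groupM // (subsetP sNA).
    rewrite in_set /diag eqxx andbT; apply/fibre_baseP; split=> //.
    by apply/fibreP; split=> // i; have /rcoset_eqP-> := Hu 1.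
  rewrite -[RHS]/(x * (u 1)^-1 * u 1, 1 * ((u, s) : wT)).
  by rewrite mulgKV mul1g.
by apply/subsetP=> g /setIdP[].
Qed.

(** A complement is the graph of a homomorphism c; [phi] is c on elements supported at one place,
    [psi] is c on constant tuples. *)
Lemma fibre_split_homs :
    coprime #|N| #|iT| -> 1 < #|iT| -> [splits fibre_group, over fibre_fst] ->
  exists phi psi : aT -> aT,
    [/\ {in N, forall b, phi b \in N}, {in N &, {morph phi : a b / a * b}}
      & {in N &, forall a b, commute (phi a) (phi b)}]
 /\ [/\ {in A, forall a, psi a \in N :* a}, {in A &, {morph psi : a b / a * b}},
        {in N, forall b, psi b = phi b ^+ #|iT|}
      & {in N & A, forall b a, phi (b ^ a) = phi b ^ psi a}].
Proof.
move=> coNi ntI /splitsP[T /complP[tiMT defG]].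
pose good x (w : wT) := (x, w) \in fibre_set.
have exT x w : good x w -> exists2 y, y \in N :* x & (y, w) \in T.
  rewrite /good -defG => /mulsgP[[n v] [y w'] /fibre_fstP[Nn ->] Tyw [-> ew]].
  have {ew}-> : w = w' by rewrite -[RHS]mul1g ew.
  by exists y => //; rewrite mem_rcoset invMg mulKVg groupV.
have unT y y' w : (y, w) \in T -> (y', w) \in T -> y = y'.
  move=> Ty Ty'; have : (y * y'^-1, w * w^-1) \in fibre_fst :&: T.
    have Tq : (y * y'^-1, w * w^-1) \in T := groupM Ty (groupVr Ty').
    rewrite in_setI Tq andbT; apply/fibre_fstP; split; last exact: mulgV.
    have : (y * y'^-1, w * w^-1) \in fibre_group.
      by rewrite /= -defG -[X in X \in _]mul1g mem_mulg ?group1.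
    rewrite mulgV wreath1 => /fibreP[_ /(_ 1)].
    by rewrite ffunE mem_rcoset mul1g groupV.
  rewrite tiMT => /set1P[/(canRL (mulgK _)) + _].
  by rewrite invgK mul1g.
(* The default 1 is never taken on a [good] element, and c is only evaluated there. *)
pose c w := odflt 1 [pick y | (y, w) \in T].
have cE y w : (y, w) \in T -> c w = y.
  move=> Ty; rewrite /c; case: pickP => [z Tz | /(_ y)]; last by rewrite Ty.
  exact: unT Tz Ty.
have cT x w : good x w -> (c w, w) \in T.
  by case/exT=> y _ Ty; rewrite (cE y).
have cN x w : good x w -> c w \in N :* x.
  by case/exT=> y Ny Ty; rewrite (cE y).
have cM x y v w : good x v -> good y w -> c (v * w) = c v * c w.
  move=> /cT Tv /cT Tw; apply: cE; exact: (groupM Tv Tw).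
pose d i b : wT := ([ffun k => if k == i then b else 1], 1).
pose e a : wT := ([ffun=> a], 1).
pose sh s : wT := ([ffun=> 1], s).
have gd i b : b \in N -> good 1 (d i b).
  move=> Nb; apply/fibreP; split=> // k; rewrite ffunE mulg1.
  by case: ifP.
have ge a : a \in A -> good a (e a).
  by move=> Aa; apply/fibreP; split=> // k; rewrite ffunE rcoset_refl.
have gs s : good 1 (sh s).
  by apply/fibreP; split=> // k; rewrite ffunE mulg1.
have shM s t : sh s * sh t = sh (s * t).
  by congr (_, _); apply/ffunP=> k; rewrite !ffunE mulg1.
(* The order of this value divides [#|N|], as it lies in N, and [#|iT|], as s ^+ [#|iT|] = 1. *)
have c_sh s : c (sh s) = 1.
  have Ns : c (sh s) \in N by have := cN _ _ (gs s); rewrite mulg1.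
  have shX n : c (sh (s ^+ n)) = c (sh s) ^+ n.
    elim: n => [|n IHn]; first by apply: cE; apply: (group1 T).
    by rewrite !expgS -shM (cM _ _ _ _ (gs _) (gs _)) IHn.
  apply/eqP; rewrite -order_eq1 -dvdn1 -(eqP coNi) dvdn_gcd order_dvdG //=.
  by rewrite order_dvdn -shX -cardsT expg_cardG ?inE // (shX 0).
(* The shift by i conjugates one place to the other, and c kills shifts. *)
have dC i b : b \in N -> c (d i b) = c (d 1 b).
  move=> Nb; have : sh i * d i b = d 1 b * sh i.
    congr (_, _); rewrite /= ?mulg1 ?mul1g //; apply/ffunP=> k.
    by rewrite !ffunE mul1g mulg1 -{2}[i]mul1g (inj_eq (mulIg i)).
  move/(congr1 c); rewrite (cM _ _ _ _ (gs _) (gd _ _ Nb)).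
  by rewrite (cM _ _ _ _ (gd _ _ Nb) (gs _)) !c_sh mul1g mulg1.
have dM i a b : d i a * d i b = d i (a * b).
  congr (_, _); rewrite /= ?mulg1 //; apply/ffunP=> k.
  by rewrite !ffunE mulg1; case: ifP; rewrite ?mulg1.
exists (fun b => c (d 1 b)), (fun a => c (e a)); split; split.
- by move=> b Nb; have := cN _ _ (gd 1 b Nb); rewrite mulg1.
- by move=> a b Na Nb; rewrite -dM (cM _ _ _ _ (gd _ _ Na) (gd _ _ Nb)).
(* By [dC], b may be moved to a second place j, where it commutes with a at place 1. *)
- move=> a b Na Nb; have [j _ nj1] : exists2 j, j \in [set: iT] & j != 1.
    by apply/trivgPn; rewrite trivg_card1 cardsT neq_ltn ntI orbT.
  rewrite -(dC j b) // /commute.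
  rewrite -(cM _ _ _ _ (gd _ _ Na) (gd _ _ Nb)).
  rewrite -(cM _ _ _ _ (gd _ _ Nb) (gd _ _ Na)); congr c.
  congr (_, _); apply/ffunP=> k; rewrite !ffunE mulg1.
  by case: (k =P 1) => [->|_]; rewrite ?mul1g ?mulg1 //
    eq_sym (negPf nj1) mulg1 mul1g.
- by move=> a Aa; apply: cN (ge a Aa).
- move=> a b Aa Ab; rewrite -(cM _ _ _ _ (ge _ Aa) (ge _ Ab)); congr c.
  by congr (_, _); rewrite /= ?mulg1 //; apply/ffunP=> k; rewrite !ffunE.
(* The constant tuple is built up one place at a time, each place contributing a factor phi b. *)
- move=> b Nb.
  pose f (r : seq iT) : wT := ([ffun k => if k \in r then b else 1], 1).
  have gf r : good 1 (f r).
    by apply/fibreP; split=> // k; rewrite ffunE mulg1; case: ifP.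
  have fX r : uniq r -> c (f r) = c (d 1 b) ^+ size r.
    elim: r => [_|j r IHr /= /andP[r'j /IHr{}IHr]].
      apply: cE; have -> : f [::] = 1; last exact: (group1 T).
      by congr (_, _); apply/ffunP=> k; rewrite !ffunE.
    rewrite expgS -IHr -(dC j) // -(cM _ _ _ _ (gd _ _ Nb) (gf r)); congr c.
    congr (_, _); rewrite /= ?mulg1 //; apply/ffunP=> k.
    rewrite !ffunE inE mulg1.
    by case: (k =P j) => [->|_]; rewrite ?(negPf r'j) ?mulg1 ?mul1g.
  rewrite cardE -fX ?enum_uniq //; congr c; congr (_, _); apply/ffunP=> k.
  by rewrite !ffunE mem_enum.
move=> b a Nb Aa; have Nba : b ^ a \in N by rewrite memJ_norm // (subsetP nNA).
apply: (mulgI (c (e a))); rewrite -conjgC.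
rewrite -(cM _ _ _ _ (ge _ Aa) (gd _ _ Nba)).
rewrite -(cM _ _ _ _ (gd _ _ Nb) (ge _ Aa)).
congr c; congr (_, _); rewrite /= ?mulg1 //; apply/ffunP=> k.
rewrite !ffunE mulg1.
by case: ifP; rewrite -?conjgC // mulg1 mul1g.
Qed.

Lemma fibre_nonsplit (z i j : aT) :
    coprime #|N| #|iT| -> 1 < #|iT| -> odd #|iT| ->
    z \in A -> i \in N -> j \in N ->
    z ^+ 2 = [~ z, i] -> z ^+ 4 = 1 -> i ^+ 2 = [~ i, j] ->
    (forall y g, y \in N :* z -> g \in N -> g ^+ 2 = 1 -> y ^+ 2 <> [~ y, g]) ->
  ~~ [splits fibre_group, over fibre_fst].
Proof.
move=> coNi ntI oddI Az Ni Nj z2 z4 i2 no_square; apply/negP.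
case/(fibre_split_homs coNi ntI)=> phi [psi [[phiN phiM phiC]]].
case=> psiN psiM psiX phiJ.
pose f := Morphism phiM.
have Nz2 : z ^+ 2 \in N.
  by rewrite z2 commgEr groupM // memJ_norm ?groupV // (subsetP nNA).
apply: (no_square (psi z) (phi i)); rewrite ?psiN ?phiN //.
  rewrite -[phi i]/(f i) -morphX // i2 morphR //=.
  exact/eqP/commgP/phiC.
(* With [#|iT|] = 1 + 2m, the factor phi (z^2)^(2m) = phi (z^4)^m vanishes. *)
rewrite expg2 -psiM // -expg2 psiX // -(odd_double_half #|iT|) oddI -mul2n.
rewrite expgD expg1 expgM -[phi _]/(f _) -morphX // -expgM z4.
rewrite morph1 expg1n mulg1.
(* Since z need not lie in N, [z, i] is expanded as (i^-1)^z i, and [phiJ] turns conjugation by z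
   into conjugation by psi z. *)
rewrite z2 commgEr morphM ?groupV ?memJ_norm ?groupV ?(subsetP nNA z) //=.
by rewrite phiJ ?groupV // -[phi i^-1]/(f i^-1) morphV // -commgEr.
Qed.

End WreathFibreProduct.

(** * The properties of Q_8 inherited by L *)

(** What the argument needs of L, phrased so that it pulls back along a split surjection. The
    homomorphism e to C_2 is valued in [bool] under xor. *)
Definition quaternion_like (lT : finGroupType) (L : {group lT}) : Prop :=
  exists e : lT -> bool,
  [/\ {in L &, {morph e : a b / a * b >-> a (+) b}},
      exists i j, [/\ i \in L, j \in L, e i & i ^+ 2 = [~ i, j]],
      {in L, forall k, k ^+ 2 = 1 -> ~~ e k}
    & {in L &, forall l k, e l -> k ^+ 2 = 1 -> l ^+ 2 <> [~ l, k]}].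

(** Take e with kernel <x>, i = y and j = x. The only involution is central, so [l, k] = 1 whenever
    k^2 = 1, while elements outside <x> have order 4. *)
Lemma quaternion_like_Q8 (qT : finGroupType) (Q : {group qT}) :
  Q \isog 'Q_8 -> quaternion_like Q.
Proof.
move=> isoQ.
have [[x y] genQ [oy y2 xy]] := @generators_quaternion _ Q 3 isT isoQ.
have [oQ Qx ox /setDP[Qy X'y]] := genQ.
have [[_ oX' _] _ [defZ _ uniq_inv _ _] _ _] :=
  @quaternion_structure _ Q 3 x y isT genQ isoQ.
have sXQ : <[x]> \subset Q by rewrite cycle_subG.
have iX : #|Q : <[x]>| = 2 by rewrite -divgS // oQ -orderE ox.
have Z_inv k : k \in Q -> k ^+ 2 = 1 -> k \in 'Z(Q).
  move=> Qk k2; have [-> | ntk] := eqVneq k 1; first exact: group1.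
  by rewrite (uniq_inv k) ?defZ ?cycle_id // ; apply: nt_prime_order.
have nX k : k \in Q -> k ^+ 2 = 1 -> k \in <[x]>.
  move=> Qk k2; apply: contraT => X'k.
  have ok : #[k] = 4 by apply: oX'; rewrite inE X'k.
  by move/eqP: k2; rewrite -order_dvdn ok.
exists (fun a => a \notin <[x]>); split.
- move=> a b Qa Qb /=; have [Xa | X'a] := boolP (a \in _).
    by rewrite groupMl.
  have [Xb | X'b] := boolP (b \in _); first by rewrite groupMr // X'a.
  have : a \in <[x]> :* b^-1.
    by rewrite (rcoset_index2 sXQ iX) !inE ?groupV ?X'a ?X'b.
  by rewrite mem_rcoset invgK => ->.
- exists y, x; split=> //; by rewrite y2 commgEr conjVg xy invgK.
- by move=> k Qk /(nX k Qk) Xk; rewrite negbK.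
move=> l k Ql Qk X'l k2.
have /centP cZ : k \in 'C(Q) by case/setIP: (Z_inv k Qk k2).
have /commgP/eqP-> : commute l k by apply/esym/cZ.
by move/(nX l Ql)=> Xl; rewrite Xl in X'l.
Qed.

(** Compose e with the projection of L onto Q along K; i and j stay in Q, and the forbidden
    equations project to Q. *)
Lemma quaternion_like_sdprod (gT : finGroupType) (K Q L : {group gT}) :
  K ><| Q = L -> quaternion_like Q -> quaternion_like L.
Proof.
move=> defL [e [eM [i [j [Qi Qj ei ij]]] e1 e2]].
have /sdprod_context[nsKL sQL KQ _ tiKQ] := defL.
have compl : Q \in [complements to K in L] by apply/complP.
have rM := remgrM compl nsKL.
pose rho := Morphism rM.
have rQ l : l \in L -> rho l \in Q by rewrite /= -KQ => /mem_remgr.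
have r1 : rho 1 = 1 := morph1 rho.
have rid q : q \in Q -> rho q = q by move=> Qq; exact: (remgr_id tiKQ Qq).
exists (e \o rho); split=> /=.
- move=> a b La Lb /=; by rewrite (rM a b La Lb) eM ?(rQ a) ?(rQ b).
- by exists i, j; rewrite (subsetP sQL i) ?(subsetP sQL j) //= [remgr _ _ _]rid.
- move=> k Lk k2; apply: e1; first exact: rQ.
  by rewrite -[remgr _ _ _]/(rho k) -(morphX rho) // k2 r1.
move=> l k Ll Lk el k2 lk; apply: (e2 (rho l) (rho k)); rewrite ?rQ //.
  by rewrite -(morphX rho) // k2 r1.
by rewrite -(morphX rho) // -(morphR rho) // lk.
Qed.

(** * The group A, extending a copy of N by an element z of order 4 *)

Section QuadraticExtension.

Variables (dT lT : finGroupType) (z r : dT) (L : {group lT}) (e : lT -> bool).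
Hypotheses (z4 : z ^+ 4 = 1) (z2 : z ^+ 2 != 1) (r2 : r ^+ 2 = 1).
Hypothesis zr : z ^ r = z^-1.
Hypothesis eM : {in L &, {morph e : a b / a * b >-> a (+) b}}.
Local Notation aT := (dT * lT)%type.

(* A is realised inside dT * L: the first coordinate of (r^(e l), l) inverts
   z exactly when e l holds, so C_4 is <(z, 1)> and L is the image of twist. *)
Definition twist (l : lT) : aT := (r ^+ e l, l).

Lemma twistM : {in L &, {morph twist : a b / a * b}}.
Proof.
move=> a b La Lb; congr (_, _); rewrite /= eM //.
by case: (e a) (e b) => [] [] //=; rewrite ?expg1 ?mulg1 ?mul1g.
Qed.
Canonical twist_morphism := Morphism twistM.

Definition twisted : {group aT} := (twist @* L)%G.
Local Notation zz := ((z, 1) : aT).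

Lemma expg_pairg1 n : zz ^+ n = (z ^+ n, 1).
Proof. exact/esym/(morphX (pairg1_morphism dT lT) n (in_setT z)). Qed.

Lemma pairg1_sqV : zz ^+ 2 = zz ^- 2.
Proof. by apply/eqP; rewrite eq_sym eq_invg_mul -expgD expg_pairg1 z4. Qed.

Lemma conjg_twist l : zz ^ twist l = if e l then zz^-1 else zz.
Proof.
by rewrite /twist; case: (e l); congr (_, _);
  rewrite /= ?mul1g ?mulVg ?expg0 ?invg1 ?mul1g ?mulg1.
Qed.

Let zz2C l : l \in L -> commute (twist l) (zz ^+ 2).
Proof.
move=> Ll; apply/esym/commgP/conjg_fixP; rewrite conjXg conjg_twist.
by case: ifP; rewrite // expgVn -pairg1_sqV.
Qed.

(** This is the copy of N inside A: z^2 generates the factor C_2, being fixed when z is inverted. *)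
Definition ext_base : {group aT} := (twisted <*> <[zz ^+ 2]>)%G.
Definition ext : {group aT} := (ext_base <*> <[zz]>)%G.

Lemma twisted_dprod : twisted \x <[zz ^+ 2]> = ext_base.
Proof.
rewrite dprodEY //.
  rewrite cycle_subG; apply/centP=> _ /morphimP[l _ Ll ->].
  exact/esym/zz2C.
apply/trivgP/subsetP=> _ /setIP[/morphimP[l _ Ll ->] /cycleP[k]].
rewrite -expgM expg_pairg1 => -[_ ->].
have := morph1 twist_morphism; rewrite /= => ->.
exact: group1.
Qed.

Lemma ext_baseP g : g \in ext_base ->
  exists l k, [/\ l \in L & g = (r ^+ e l * z ^+ (2 * k), l)].
Proof.
have /dprodP[_ <- _ _] := twisted_dprod.
case/mulsgP=> _ _ /morphimP[l _ Ll ->] /cycleP[k ->] ->.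
exists l, k; split=> //; rewrite -expgM expg_pairg1.
by congr (_, _); rewrite /= mulg1.
Qed.

(** Conjugation by z multiplies [twist l] by [twist l, z], which is 1 or z^2. *)
Lemma ext_base_normal : ext_base <| ext.
Proof.
have sZ : zz ^+ 2 \in ext_base by rewrite mem_gen // inE cycle_id orbT.
rewrite /normal joing_subl join_subG normG cycle_subG inE.
apply/subsetP=> _ /imsetP[g + ->]; have /dprodP[_ <- _ _] := twisted_dprod.
case/mulsgP=> _ _ /morphimP[l _ Ll ->] /cycleP[k ->] ->.
have /dprodP[_ -> _ _] := twisted_dprod.
have Etw : twist l \in ext_base by rewrite mem_gen // inE mem_morphim.
rewrite conjMg !conjXg [zz ^ zz]conjgE mulKg; apply: groupM; last exact: groupX.
rewrite conjg_mulR groupM // commgEr conjVg conjg_twist.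
by case: ifP; rewrite ?invgK ?mulVg ?group1.
Qed.

(** Second coordinates force e to vanish on those of both g and y. The first coordinates are then
    powers of z, so they commute, and y^2 would be trivial there. *)
Lemma ext_base_no_square y g :
    {in L, forall k, k ^+ 2 = 1 -> ~~ e k} ->
    {in L &, forall l k, e l -> k ^+ 2 = 1 -> l ^+ 2 <> [~ l, k]} ->
  y \in ext_base :* (z, 1) -> g \in ext_base -> g ^+ 2 = 1 ->
  y ^+ 2 <> [~ y, g].
Proof.
move=> e1 e2 /rcosetP[_ /ext_baseP[l [m [Ll ->]]] ->] /ext_baseP[k [n [Lk ->]]].
case=> _ k2 [yg1 yg2]; rewrite mulg1 in yg2.
have nek : ~~ e k by apply: e1 k2.
have nel : ~~ e l by apply/negP=> el; apply: (e2 l k Ll Lk el k2 yg2).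
move: yg1; rewrite (negPf nek) (negPf nel) !mul1g -expgSr.
rewrite [RHS](_ : _ = 1); last first.
  by apply/eqP/commgP; apply: commuteX2.
(* The square is z^(4m + 2) = z^2, which is not 1. *)
rewrite -expgD addSn addnS addnn -mul2n mulnA -addn2 expgD.
rewrite expgM z4 expg1n mul1g.
exact/eqP.
Qed.

End QuadraticExtension.

(** * Assembling the counterexample *)

Lemma gaschutz_counterexample (iT nT : finGroupType) (L Z N : {group nT}) :
    quaternion_like L -> L \x Z = N -> #|Z| = 2 ->
    coprime #|N| #|iT| -> 1 < #|iT| ->
  exists (gT : finGroupType) (G H M : {group gT}),
    [/\ M \isog N, M <| G, M \subset H & H \subset G] /\
    [/\ coprime #|M| #|G : H|, [splits H, over M] & ~~ [splits G, over M]].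
Proof.
move=> [e [eM [i [j [Li Lj ei ij]]] e1 e2]] defN oZ coNi ntI.
(* A rotation z and a reflection r of the dihedral group of order 8 realise the inversion of C_4. *)
have [[z r] [_ _ oz _] [or zr]] :=
  @generators_2dihedral _ [set: 'D_8] 3 isT (isog_refl _).
have z4 : z ^+ 4 = 1 by have := expg_order z; rewrite oz.
have z2 : z ^+ 2 != 1 by rewrite -order_dvdn oz.
have r2 : r ^+ 2 = 1 by have := expg_order r; rewrite or.
pose A := ext z r2 eM; pose B := ext_base z r2 eM.
have nsBA : B <| A := ext_base_normal z4 r2 zr eM.
have isoB : B \isog N.
  rewrite isog_sym; apply: (isog_dprod defN (twisted_dprod z4 r2 zr eM)).
    apply/isogP; exists (twist_morphism r2 eM) => //.
    by apply/injmP=> a b _ _ [].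
  rewrite isog_cyclic_card ?cycle_cyclic; last first.
    by apply: prime_cyclic; rewrite oZ.
  rewrite oZ -orderE; apply/eqP/nt_prime_order => //.
    by rewrite -expgM expg_pairg1 z4.
  by rewrite expg_pairg1; apply: contra z2 => /eqP[->].
have Btw l : l \in L -> twist r e l \in B.
  by move=> Ll; rewrite mem_gen // inE (mem_morphim (twist_morphism r2 eM)).
have oddI : odd #|iT|.
  rewrite -coprime2n; apply: coprime_dvdl coNi.
  by rewrite -oZ -(dprod_card defN) dvdn_mull.
exists _, (fibre_group iT nsBA), (fibre_base iT nsBA), (fibre_fst iT B).
split; split.
- by rewrite (isog_trans _ isoB) // isog_sym isog_setX1.
- exact: fibre_fst_normal.
- exact: fibre_fst_sub_base.
- exact: subsetIl.
- rewrite (coprime_dvdr (fibre_base_index iT nsBA)) //.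
  by rewrite cardsX cards1 muln1 (card_isog isoB).
- exact: fibre_base_splits.
apply: (@fibre_nonsplit _ _ _ _ nsBA (z, 1) (twist r e i) (twist r e j)) => //.
- by rewrite (card_isog isoB).
- by rewrite mem_gen // inE cycle_id orbT.
- exact: Btw.
- exact: Btw.
(* As e i holds, [z, i] = z^-1 z^-1 = z^-2, which is z^2. *)
- by rewrite commgEl conjg_twist // ei -invMg (pairg1_sqV _ z4).
- by rewrite expg_pairg1 z4.
- rewrite -[twist r e i]/(twist_morphism r2 eM i).
  by rewrite -[twist r e j]/(twist_morphism r2 eM j) -morphX // -morphR // ij.
by move=> y g By Bg; apply: (ext_base_no_square z4 z2 zr e1 e2 By Bg).
Qed.

Theorem mainTheorem4 (nT : finGroupType) (N : {group nT})
    (hN : is_C3C3_Q8_x_C2 N) :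
  ~ gaschutz_holds N /\
  exists (gT : finGroupType) (G H M : {group gT}),
    [/\ M \isog N, M <| G, M \subset H & H \subset G] /\
    [/\ coprime #|M| #|G : H|, [splits H, over M] & ~~ [splits G, over M]].
Proof.
have [K [Q [L [Z [[isoK isoQ isoZ] [defL _ defN]]]]]] := hN.
have oZ : #|Z| = 2 by rewrite (card_isog isoZ) cardsT card_ord.
have oN : #|N| = 144.
  rewrite -(dprod_card defN) oZ -(sdprod_card defL) (card_isog isoQ).
  rewrite (card_isog isoK) (@card_quaternion 3) //.
  by rewrite cardsT card_prod !card_ord.
have qL := quaternion_like_sdprod defL (quaternion_like_Q8 isoQ).
(* 5 is the least prime not dividing 144, so I = C_5. *)
have [||gT [G [H [M [P1 P2]]]]] :=
  @gaschutz_counterexample 'Z_5 _ _ _ _ qL defN oZ.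
- by rewrite oN card_ord.
- by rewrite card_ord.
split; last by exists gT, G, H, M.
move=> gN; case: P1 P2 => isoM nsMG sMH sHG [co splH /negP[]].
exact: gN splH.
Qed.
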